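(* For all integers $d\geq 1$ and $f\geq d+1$, the 2-sumfree sequence $S_{f,f+d}$ is ultimately periodic.
   Context: For positive integers $f<g$, the (greedy, strict) 2-sumfree sequence $S_{f,g}=(s_1,s_2,s_3,\ldots)$ is defined by $s_1=f$, $s_2=g$, and, for $n>2$, $s_n$ is the smallest integer exceeding $s_{n-1}$ that is not equal to the sum of two different elements among $s_1,\ldots,s_{n-1}$. The characteristic sequence of a strictly increasing sequence $S$ of positive integers is $C=(C_1,C_2,\ldots)$ with $C_z=1$ if $z$ is an entry of $S$ and $C_z=0$ otherwise. The sequence $S$ is called ultimately periodic if its characteristic sequence $C$ is ultimately periodic (equivalently, its sequence of first differences $(s_{n+1}-s_n)_{n\geq 1}$ is ultimately periodic). *)

(* Defs.v *)
From mathcomp Require Import all_boot.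
From mathcomp Require Import boolp.

Set Implicit Arguments.
Unset Strict Implicit.
Unset Printing Implicit Defensive.

Definition sum_of_two_distinct (l : seq nat) (z : nat) : bool :=
  has (fun x => has (fun y => (x != y) && (z == x + y)) l) l.

Lemma next_term_exists (l : seq nat) :
  exists z, (last 0 l < z) && ~~ sum_of_two_distinct l z.
Proof.
have le_sumn x : x \in l -> x <= sumn l.
  by move=> xl; rewrite (perm_sumn (perm_to_rem xl)) /= leq_addr.
exists (sumn l + sumn l).+1; apply/andP; split.
  rewrite ltnS; case: l le_sumn => [//|a l] H.
  by apply: leq_trans (leq_addr _ _); apply: H; rewrite /= mem_last.
apply/hasPn => x xl; apply/hasPn => y yl; rewrite negb_and; apply/orP; right.
by rewrite gtn_eqF // ltnS leq_add ?le_sumn.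
Qed.

Definition next_term (l : seq nat) : nat := ex_minn (next_term_exists l).

Fixpoint sumfree_prefix (f g n : nat) : seq nat :=
  if n is n'.+1 then
    rcons (sumfree_prefix f g n') (next_term (sumfree_prefix f g n'))
  else [:: f; g].

(* Indexed from 0: sumfree f g n is s_(n+1). The prefix used here consists of
   the n + 2 terms s_1, ..., s_(n+2). *)
Definition sumfree (f g n : nat) : nat := nth 0 (sumfree_prefix f g n) n.

Lemma size_sumfree_prefix f g n : size (sumfree_prefix f g n) = n.+2.
Proof. by elim: n => //= n IH; rewrite size_rcons IH. Qed.

Lemma nth_sumfree_prefix f g n i :
  i < n.+2 -> nth 0 (sumfree_prefix f g n) i = sumfree f g i.
Proof.
have step m k : k < m.+2 ->
    nth 0 (sumfree_prefix f g m.+1) k = nth 0 (sumfree_prefix f g m) k.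
  by move=> lt_km; rewrite /= nth_rcons size_sumfree_prefix lt_km.
have up m k j : k < m.+2 ->
    nth 0 (sumfree_prefix f g (m + j)) k = nth 0 (sumfree_prefix f g m) k.
  move=> lt_km; elim: j => [|j IH]; first by rewrite addn0.
  by rewrite addnS step // (leq_trans lt_km) // !ltnS leq_addr.
move=> lt_in; rewrite /sumfree; case: (leqP i n) => [le_in|lt_ni].
  by rewrite -(subnKC le_in) up.
have -> : i = n.+1 by apply/eqP; rewrite eqn_leq -ltnS lt_in.
by rewrite step.
Qed.

Lemma sumfree0 f g : sumfree f g 0 = f.
Proof. by []. Qed.

Lemma sumfree1 f g : sumfree f g 1 = g.
Proof. by []. Qed.

Lemma sumfreeSS f g n :
  sumfree f g n.+2 = next_term (mkseq (sumfree f g) n.+2).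
Proof.
have -> : mkseq (sumfree f g) n.+2 = sumfree_prefix f g n.
  apply: (@eq_from_nth _ 0); rewrite size_mkseq ?size_sumfree_prefix //.
  by move=> i lt_in; rewrite nth_mkseq // nth_sumfree_prefix.
rewrite -(@nth_sumfree_prefix f g n.+1 n.+2) //=.
by rewrite nth_rcons size_sumfree_prefix ltnn eqxx.
Qed.

(* Also defined at z = 0, which is immaterial for ultimate periodicity. *)
Definition characteristic (s : nat -> nat) (z : nat) : nat :=
  if `[< exists n, s n = z >] then 1 else 0.

Definition ultimately_periodic_seq (T : Type) (u : nat -> T) : Prop :=
  exists N p : nat, 0 < p /\ forall n, N <= n -> u (n + p) = u n.

(* Ultimate periodicity of an increasing sequence of positive integers refers
   to its characteristic sequence, not to its terms. *)
Definition ultimately_periodic (s : nat -> nat) : Prop :=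
  ultimately_periodic_seq (characteristic s).

(* Main.v *)
Require Import Defs.
From mathcomp Require Import all_boot.
From mathcomp Require Import boolp zify.

(** The sequence can be written down explicitly.  Put p = 3f + d - 1.  Then the
entries of S_{f,f+d} are f itself, the initial block [f+d, 2f+d-1], and the
blocks [f+d-1, 2f+d-2] + k p for all k >= 1, which repeat with period p.

Two facts make this set the greedy one.  No element is a sum of two others:
modulo p the periodic blocks occupy the window [f+d-1, 2f+d-2], the sums of two
block elements lie in [2f+2d-2, 4f+2d-3] and the sums of a block element with f
lie in [2f+d-1, 3f+d-1], all inside the complementary window
[2f+d-1, 4f+2d-3]; and no sum is small enough to hit f or the initial block
([sum2_not_in_blocks]).  Every gap is filled by sums: f plus the k-th block
gives the lower part of the k-th gap, the initial block plus the k-th block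
gives the upper part, and d < f leaves no hole between the two parts
([sum2_or_in_blocks]).  The initial block, whose position is prescribed by its
first element f+d, is shifted by one with respect to the periodic pattern.  The
pattern still starts on time at 4f+2d-2 = (f+d-1) + p because only sums of
distinct elements count: that number is the double of the last element of the
initial block.

A set that contains exactly the non-sums beyond its two prescribed first
elements is the range of the greedy sequence ([sumfree_range]), and
periodicity of the characteristic sequence is then read off from the blocks. *)

(** * Recognizing the greedy sequence *)

Definition sum2 (P : nat -> Prop) (z : nat) : Prop :=
  exists x y, [/\ P x, P y, x <> y & z = x + y].

Lemma sum_of_two_distinctP (l : seq nat) (z : nat) :
  reflect (sum2 (fun x => x \in l) z) (sum_of_two_distinct l z).
Proof.
apply: (iffP hasP) => [[x xl /hasP[y yl /andP[/eqP neq_xy /eqP ->]]]|].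
  by exists x, y.
move=> [x [y [xl yl /eqP neq_xy ->]]].
by exists x => //; apply/hasP; exists y => //; rewrite neq_xy eqxx.
Qed.

Lemma next_termP (l : seq nat) :
  [/\ last 0 l < next_term l, ~ sum2 (fun x => x \in l) (next_term l)
    & forall z, last 0 l < z < next_term l -> sum2 (fun x => x \in l) z].
Proof.
rewrite /next_term; case: ex_minnP => m /andP[lt_lm nsum_m] min_m.
split=> // [/sum_of_two_distinctP|z /andP[lt_lz lt_zm]]; first exact/negP.
apply/sum_of_two_distinctP; apply: contraLR lt_zm => nsum_z.
by rewrite -leqNgt min_m // lt_lz.
Qed.

Lemma last_sumfree_prefix (f g n : nat) : n <= last 0 (sumfree_prefix f g n).
Proof.
elim: n => [//|n IHn] /=; rewrite last_rcons.
by have [lt_last _ _] := next_termP (sumfree_prefix f g n); lia.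
Qed.

Lemma mem_sumfree_prefix (f g n z : nat) :
  z \in sumfree_prefix f g n -> exists i, sumfree f g i = z.
Proof.
move=> /(nthP 0)[i]; rewrite size_sumfree_prefix => lt_in <-.
by exists i; rewrite (nth_sumfree_prefix f g).
Qed.

Section GreedyRange.

Variables (f g : nat) (P : nat -> Prop).
Hypotheses (f_gt0 : 0 < f) (lt_fg : f < g).
Hypothesis P_start : forall z, z <= g -> P z <-> z = f \/ z = g.
Hypothesis P_greedy : forall z, g < z -> P z <-> ~ sum2 P z.

(** The values skipped by the greedy rule are sums of earlier entries, hence
outside P; so every element of P below the next term is already listed, and
being a sum of entries of the list is the same as being a sum of elements of
P. *)
Lemma sumfree_prefix_initial (n : nat) :
  let l := sumfree_prefix f g n in
  g <= last 0 l /\ forall z, z \in l <-> P z /\ z <= last 0 l.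
Proof.
elim: n => [|n [le_g memP]] /=.
  split=> // z; rewrite !inE; split=> [/orP|[Pz le_zg]]; last first.
    by have /(P_start _ le_zg) := Pz; lia.
  move=> z_fg; have le_zg : z <= g by lia.
  by split=> //; apply/P_start; lia.
set l := sumfree_prefix f g n in le_g memP *.
have [lt_lm nsum_m sum_below] := next_termP l.
set m := next_term l in lt_lm nsum_m sum_below *.
have listed z : P z -> z < m -> z \in l.
  move=> Pz lt_zm; apply/memP; split=> //; rewrite leqNgt; apply/negP => lt_lz.
  have [x [y [/memP[Px _] /memP[Py _] neq_xy def_z]]] :
    sum2 (fun x => x \in l) z by apply: sum_below; rewrite lt_lz.
  have lt_gz : g < z by apply: leq_ltn_trans lt_lz.
  by move/(P_greedy _ lt_gz): Pz; apply; exists x, y.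
have P_gt0 z : P z -> 0 < z.
  by case: z => // P0; have /(P_start _ (leq0n g)) := P0; lia.
have Pm : P m.
  apply/P_greedy; first by apply: leq_ltn_trans lt_lm.
  move=> [x [y [Px Py neq_xy def_m]]]; apply: nsum_m; exists x, y.
  have [x_gt0 y_gt0] := (P_gt0 _ Px, P_gt0 _ Py).
  by split=> //; apply: listed => //; lia.
rewrite last_rcons; split=> [|z]; first by lia.
rewrite mem_rcons inE; split=> [/orP[/eqP->//|/memP[Pz le_zl]]|[Pz le_zm]].
  by split=> //; lia.
by have [//|neq_zm] := eqVneq z m; apply: listed => //; lia.
Qed.

(** Unlisted elements of P would exceed every prefix, but the last term of the
prefix with n + 2 terms is at least n. *)
Lemma sumfree_range (z : nat) : (exists n, sumfree f g n = z) <-> P z.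
Proof.
split=> [[n <-]|Pz].
  have [_ memP] := sumfree_prefix_initial n.
  apply: (proj1 (iffLR (memP _) _)).
  by rewrite -(@nth_sumfree_prefix f g n) // mem_nth // size_sumfree_prefix.
have [_ memP] := sumfree_prefix_initial z.
by apply: (@mem_sumfree_prefix f g z); apply/memP; rewrite last_sumfree_prefix.
Qed.

End GreedyRange.

(** * The block structure *)

Lemma neq_of_window (p k l u v : nat) :
  u < v -> v < u + p -> k * p + u <> l * p + v.
Proof. by move=> lt_uv lt_vup; have [le_kl|lt_lk] := leqP k l; nia. Qed.

Section Blocks.

Variables d f : nat.
Hypotheses (d_gt0 : 0 < d) (lt_df : d < f).

Definition block_period : nat := 3 * f + d - 1.
Let p := block_period.

Definition in_blocks (z : nat) : Prop :=
  [\/ z = f, f + d <= z < 2 * f + d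
    | exists k u, [/\ 0 < k, f + d - 1 <= u < 2 * f + d - 1 & z = k * p + u]].

Let pE : p + 1 = 3 * f + d.
Proof. by rewrite /p /block_period; lia. Qed.

Let le_mul_p k : 0 < k -> p <= k * p.
Proof. by move=> k_gt0; rewrite leq_pmull. Qed.

(** The subtracted boolean is 1 except in the gap with k = 0, which starts one
step later because it follows the shifted initial block. *)
Definition in_gaps (z : nat) : Prop :=
  exists k w, [/\ 2 * f + d - (0 < k) <= w < 4 * f + 2 * d - 2
                & z = k * p + w].

Lemma in_gaps_not_in_blocks (z : nat) : in_gaps z -> ~ in_blocks z.
Proof.
move=> [k [w [w_gap ->]]] [||[l [u [l_gt0 u_block]]]].
- by case: k w_gap => [|k] w_gap; [|have := le_mul_p k.+1 isT]; lia.
- by case: k w_gap => [|k] w_gap; [|have := le_mul_p k.+1 isT]; lia.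
- by move/esym; apply: neq_of_window; lia.
Qed.

Lemma sum2_in_gaps (z : nat) : sum2 in_blocks z -> in_gaps z.
Proof.
move=> [x [y [+ + neq_xy ->]]].
move=> [Ex|x0|[k [u [k_gt0 u_block Ex]]]]
       [Ey|y0|[l [v [l_gt0 v_block Ey]]]].
- by lia.
- by exists 0, (x + y); lia.
- by exists l, (f + v); lia.
- by exists 0, (x + y); lia.
- by exists 0, (x + y); lia.
- by exists l, (x + v); lia.
- by exists k, (f + u); lia.
- by exists k, (u + y); lia.
- by exists (k + l), (u + v); rewrite mulnDl; lia.
Qed.

Lemma sum2_not_in_blocks (z : nat) : sum2 in_blocks z -> ~ in_blocks z.
Proof. by move=> /sum2_in_gaps /in_gaps_not_in_blocks. Qed.

Lemma in_blocks_or_in_gaps (z : nat) : f + d < z -> in_blocks z \/ in_gaps z.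
Proof.
move=> lt_z; have [lt_z1|le_z1] := ltnP z (2 * f + d).
  by left; constructor 2; lia.
have [lt_z2|le_z2] := ltnP z (4 * f + 2 * d - 2).
  by right; exists 0, z; lia.
(* Dividing z - (f+d-1) puts the remainder of z in one period that starts with
   a block; the quotient is positive as the first full period starts at
   p + (f+d-1) = 4f+2d-2. *)
pose k := (z - (f + d - 1)) %/ p; pose r := (z - (f + d - 1)) %% p.
have Ez : z = k * p + (f + d - 1 + r).
  by have := divn_eq (z - (f + d - 1)) p; rewrite -/k -/r; lia.
have lt_rp : r < p by rewrite ltn_mod; lia.
have k_gt0 : 0 < k by rewrite divn_gt0; lia.
have [lt_rf|le_fr] := ltnP r f.
  by left; constructor 3; exists k, (f + d - 1 + r); split=> //; lia.
by right; exists k, (f + d - 1 + r); split=> //; lia.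
Qed.

(** The lower part of a gap is f plus the preceding block.  In the upper part,
one summand is the least element of the initial block as long as the other
one stays in the k-th block, and otherwise the other one is the last element
of the k-th block. *)
Lemma in_gaps_sum2 (z : nat) : in_gaps z -> sum2 in_blocks z.
Proof.
move=> [[|k] [w [w_gap ->]]].
  have [lt_w1|le_w1] := ltnP w (3 * f + d).
    by exists f, (w - f); split; [constructor 1|constructor 2|..]; lia.
  have [lt_w2|le_w2] := ltnP w (3 * f + 2 * d).
    by exists (f + d), (w - (f + d)); split; [constructor 2|constructor 2|..];
      lia.
  by exists (w - (2 * f + d - 1)), (2 * f + d - 1);
    split; [constructor 2|constructor 2|..]; lia.
have le_p := le_mul_p k.+1 isT.
have in_block u : f + d - 1 <= u < 2 * f + d - 1 -> in_blocks (k.+1 * p + u).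
  by move=> u_block; constructor 3; exists k.+1, u.
have [lt_w1|le_w1] := ltnP w (3 * f + d - 1).
  by exists f, (k.+1 * p + (w - f));
    split; [constructor 1|apply: in_block|..]; lia.
have [lt_w2|le_w2] := ltnP w (3 * f + 2 * d - 1).
  by exists (f + d), (k.+1 * p + (w - (f + d)));
    split; [constructor 2|apply: in_block|..]; lia.
by exists (w - (2 * f + d - 2)), (k.+1 * p + (2 * f + d - 2));
  split; [constructor 2|apply: in_block|..]; lia.
Qed.

Lemma sum2_or_in_blocks (z : nat) : f + d < z -> in_blocks z \/ sum2 in_blocks z.
Proof. by move=> /in_blocks_or_in_gaps[|/in_gaps_sum2]; [left|right]. Qed.

Lemma sumfree_blocks (z : nat) :
  (exists n, sumfree f (f + d) n = z) <-> in_blocks z.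
Proof.
apply: sumfree_range => {z} [||z le_z|z lt_z]; [by lia|by lia|split..].
- by move=> [||[k [u [/le_mul_p]]]]; lia.
- by move=> [|] ->; [constructor 1|constructor 2; lia].
- by move=> Bz /sum2_not_in_blocks.
- by move=> nsum_z; have [] := sum2_or_in_blocks _ lt_z.
Qed.

Lemma in_blocks_periodic (z : nat) :
  2 * f + d <= z -> in_blocks (z + p) <-> in_blocks z.
Proof.
move=> le_z; split=> [[||[k [u [k_gt0 u_block Ez]]]]|]; [by lia..| |].
  (* The block with k = 1 ends below 2f + d + p, so that k >= 2 here and the
     index can be lowered. *)
  case: k k_gt0 Ez => [//|[|k] _ Ez]; first by lia.
  by constructor 3; exists k.+1, u; split=> //; lia.
move=> [||[k [u [k_gt0 u_block ->]]]]; [by lia|by lia|].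
by constructor 3; exists k.+1, u; split=> //; lia.
Qed.

End Blocks.

Theorem theorem1 (d f : nat) (hd : 1 <= d) (hf : d + 1 <= f) :
  ultimately_periodic (sumfree f (f + d)).
Proof.
have lt_df : d < f by lia.
exists (2 * f + d), (block_period d f); split=> [|z le_z].
  by rewrite /block_period; lia.
rewrite /characteristic; congr (if _ then _ else _); apply: asbool_equiv_eq.
by rewrite !sumfree_blocks // in_blocks_periodic.
Qed.
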